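(* Let $B$ be the backward shift operator acting on $\ell^2$, $B(a_0,a_1,a_2,\dots)=(a_1,a_2,a_3,\dots)$. There exists a common hypercyclic vector for the operators $zB$, $z\in\mathbb{C}$, $|z|>1$; that is, there exists a single vector $f\in\ell^2$ such that for every complex number $z$ with $|z|>1$ the orbit $\{(zB)^n f : n\ge 0\}$ is dense in $\ell^2$.
   Context: $\ell^2$ denotes the space of all complex-valued square-summable sequences $(a_0,a_1,a_2,\dots)$ with its usual norm. For a linear topological space $X$ and a continuous linear operator $T\colon X\to X$, a vector $x\in X$ is called a hypercyclic vector for $T$ if its orbit $\{T^n x : n\ge 0\}$ is dense in $X$. A common hypercyclic vector for a family of operators is a vector that is hypercyclic for every operator in the family. *)

(* Defs.v *)
From HB Require Import structures.
From mathcomp Require Import all_boot all_order all_algebra.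
From mathcomp Require Import all_classical all_reals all_analysis.
From mathcomp Require Import complex.
From mathcomp Require Import ring.

Set Implicit Arguments.
Unset Strict Implicit.
Unset Printing Implicit Defensive.

Import Order.TTheory GRing.Theory Num.Theory.
Import numFieldNormedType.Exports.

Local Open Scope classical_set_scope.
Local Open Scope ring_scope.

Import ComplexField.Normc.

Section SquareSummable.
Context (R : realType).
Implicit Types a b : nat -> R[i].

Definition sqnorm_seq a : R^nat := fun n => normc (a n) ^+ 2.

Definition square_summable : {pred nat -> R[i]} :=
  fun a => `[< cvgn (series (sqnorm_seq a)) >].

Lemma sqnorm_seq_ge0 a n : 0 <= sqnorm_seq a n.
Proof. exact: sqr_ge0. Qed.

Lemma normc_ge0 (x : R[i]) : 0 <= normc x.
Proof. by case: x => u v; exact: sqrtr_ge0. Qed.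

Lemma sqnorm_seqD a b (s t : R) n : 0 < s -> 0 < t ->
  sqnorm_seq (a + b) n * (s * t) <=
    (s + t) * (t * sqnorm_seq a n + s * sqnorm_seq b n).
Proof.
move=> s0 t0; rewrite /sqnorm_seq.
have := @le_normcD R (a n) (b n).
have := normc_ge0 ((a + b) n); have := normc_ge0 (a n); have := normc_ge0 (b n).
rewrite [(a + b) n]/(a n + b n).
move: (normc (_ + _)) (normc (a n)) (normc (b n)) => z x y y0 x0 z0 zxy.
have z2 : z ^+ 2 <= (x + y) ^+ 2 by rewrite ler_pXn2r// nnegrE addr_ge0.
apply: (@le_trans _ _ ((x + y) ^+ 2 * (s * t))).
  by rewrite ler_wpM2r// mulr_ge0// ltW.
rewrite -subr_ge0.
have -> : (s + t) * (t * x ^+ 2 + s * y ^+ 2) - (x + y) ^+ 2 * (s * t) =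
  (t * x - s * y) ^+ 2 by ring.
exact: sqr_ge0.
Qed.

Lemma sqnorm_seqZ a (l : R[i]) :
  sqnorm_seq (l *: a) = normc l ^+ 2 *: sqnorm_seq a.
Proof. by apply/funext => n; rewrite /sqnorm_seq /= normcM exprMn. Qed.

Fact square_summable_submod_closed : submod_closed square_summable.
Proof.
split.
  apply/asboolP; have -> : sqnorm_seq 0 = 0.
    by apply/funext => n; rewrite /sqnorm_seq [normc _]normc0 expr0n.
  rewrite (_ : series 0 = cst 0); first exact: is_cvg_cst.
  by apply/funext => n; rewrite /series /= big1.
move=> l a b /asboolP ca /asboolP cb; apply/asboolP.
have cla : cvgn (series (sqnorm_seq (l *: a))).
  by rewrite sqnorm_seqZ; exact: is_cvg_seriesZ.
apply: (@series_le_cvg _ _ (2 *: (sqnorm_seq (l *: a) + sqnorm_seq b))).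
- by move=> n; exact: sqnorm_seq_ge0.
- move=> n; apply: mulr_ge0 => //.
  by apply: addr_ge0; exact: sqnorm_seq_ge0.
- move=> n; have := @sqnorm_seqD (l *: a) b 1 1 n ltr01 ltr01.
  by rewrite !mul1r mulr1.
- apply: is_cvg_seriesZ; exact: is_cvg_seriesD.
Qed.

HB.instance Definition _ :=
  GRing.isSubmodClosed.Build R[i] (nat -> R[i]) square_summable
    square_summable_submod_closed.

End SquareSummable.

Record ell2 (R : realType) := Ell2 {
  ell2_seq :> nat -> R[i] ;
  ell2P : ell2_seq \in @square_summable R }.

HB.instance Definition _ (R : realType) := [isSub for @ell2_seq R].
HB.instance Definition _ (R : realType) := [Choice of ell2 R by <:].
HB.instance Definition _ (R : realType) :=
  [SubChoice_isSubLmodule of ell2 R by <:].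

Section Ell2Norm.
Context (R : realType).
Implicit Types a b : ell2 R.

Definition ell2_rnorm a : R := Num.sqrt (limn (series (sqnorm_seq a))).

(* The norm of a normedModType over R[i] takes its values in R[i], so the real
   norm is embedded; the order of R[i] restricts to the usual one on the reals. *)
Definition ell2_norm a : R[i] := (ell2_rnorm a)%:C%C.

Lemma ell2_cvg a : cvgn (series (sqnorm_seq a)).
Proof. by have /asboolP := ell2P a. Qed.

Lemma limn_sqnorm_ge0 a : 0 <= limn (series (sqnorm_seq a)).
Proof.
apply: limr_ge; first exact: ell2_cvg.
by apply: nearW => n; apply: sumr_ge0 => i _; exact: sqnorm_seq_ge0.
Qed.

Lemma ell2_rnorm_sqr a : ell2_rnorm a ^+ 2 = limn (series (sqnorm_seq a)).
Proof. by rewrite sqr_sqrtr// limn_sqnorm_ge0. Qed.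

Lemma ell2_rnorm_ge0 a : 0 <= ell2_rnorm a.
Proof. exact: sqrtr_ge0. Qed.

Lemma ell2_ext a b : (forall n, a n = b n) -> a = b.
Proof. by move=> ab; apply/val_inj/funext. Qed.

Lemma ell2_rnorm_eq0 a : ell2_rnorm a = 0 -> a = 0.
Proof.
move=> a0; apply: ell2_ext => n; apply: eq0_normc.
apply/eqP; rewrite -sqrf_eq0 eq_le sqr_ge0 andbT.
have <- : limn (series (sqnorm_seq a)) = 0 by rewrite -ell2_rnorm_sqr a0 expr0n.
have nd : nondecreasing_seq (series (sqnorm_seq a)).
  by apply: nondecreasing_series => k _ _; exact: sqnorm_seq_ge0.
apply: le_trans (nondecreasing_cvgn_le nd (@ell2_cvg a) n.+1).
rewrite /series /= big_nat_recr//= lerDr.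
by apply: sumr_ge0 => i _; exact: sqnorm_seq_ge0.
Qed.

Lemma ell2_rnormZ (l : R[i]) a : ell2_rnorm (l *: a) = normc l * ell2_rnorm a.
Proof.
apply/eqP; rewrite -(@eqrXn2 _ 2)//; last 2 first.
- exact: ell2_rnorm_ge0.
- by rewrite mulr_ge0 ?normc_ge0 ?ell2_rnorm_ge0.
rewrite exprMn !ell2_rnorm_sqr sqnorm_seqZ lim_seriesZ//; exact: ell2_cvg.
Qed.

Lemma ell2_rnormD a b : ell2_rnorm (a + b) <= ell2_rnorm a + ell2_rnorm b.
Proof.
have [/ell2_rnorm_eq0 ->|a0] := eqVneq (ell2_rnorm a) 0.
  by rewrite add0r lerDr ell2_rnorm_ge0.
have [/ell2_rnorm_eq0 ->|b0] := eqVneq (ell2_rnorm b) 0.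
  by rewrite addr0 lerDl ell2_rnorm_ge0.
have {}a0 : 0 < ell2_rnorm a by rewrite lt0r a0 ell2_rnorm_ge0.
have {}b0 : 0 < ell2_rnorm b by rewrite lt0r b0 ell2_rnorm_ge0.
rewrite -(@ler_pXn2r _ 2)// ?nnegrE ?addr_ge0 ?ell2_rnorm_ge0//.
set s := ell2_rnorm a in a0 *; set t := ell2_rnorm b in b0 *.
have st : 0 < s * t by exact: mulr_gt0.
rewrite -(ler_pM2r st) ell2_rnorm_sqr.
have -> : (s + t) ^+ 2 * (s * t) =
    limn (series ((s + t) *: (t *: sqnorm_seq a + s *: sqnorm_seq b))).
  have ca := is_cvg_seriesZ (k := t) (ell2_cvg (a := a)).
  have cb := is_cvg_seriesZ (k := s) (ell2_cvg (a := b)).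
  rewrite lim_seriesZ; last exact: is_cvg_seriesD.
  rewrite lim_seriesD// !lim_seriesZ; [|exact: ell2_cvg..].
  rewrite -!ell2_rnorm_sqr -/s -/t /GRing.scale/=; ring.
have -> x : x * (s * t) = (s * t) *: x by rewrite mulrC.
rewrite -lim_seriesZ; last exact: ell2_cvg.
apply: lim_series_le.
- by apply: is_cvg_seriesZ; exact: ell2_cvg.
- apply: is_cvg_seriesZ; apply: is_cvg_seriesD; apply: is_cvg_seriesZ;
  exact: ell2_cvg.
- move=> n; have := @sqnorm_seqD R a b s t n a0 b0.
  by rewrite mulrC.
Qed.

Lemma ell2_normD a b : ell2_norm (a + b) <= ell2_norm a + ell2_norm b.
Proof. by rewrite /ell2_norm -rmorphD lecR ell2_rnormD. Qed.

Lemma ell2_normZ (l : R[i]) a : ell2_norm (l *: a) = `|l| * ell2_norm a.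
Proof. by rewrite /ell2_norm ell2_rnormZ rmorphM. Qed.

Lemma ell2_norm_eq0 a : ell2_norm a = 0 -> a = 0.
Proof. by move=> /complexI/ell2_rnorm_eq0. Qed.

End Ell2Norm.

HB.instance Definition _ (R : realType) :=
  @Lmodule_isNormed.Build R[i] (ell2 R) (@ell2_norm R)
    (@ell2_normD R) (@ell2_normZ R) (@ell2_norm_eq0 R).

Section BackwardShift.
Context (R : realType).
Implicit Types a : ell2 R.

Fact backshift_subproof a : (fun n => a n.+1) \in @square_summable R.
Proof.
apply/asboolP; have /cvg_ex[l al] := ell2_cvg (a := a).
apply/cvg_ex; exists (l - sqnorm_seq a 0%N).
rewrite (_ : series _ = fun n => series (sqnorm_seq a) n.+1 - sqnorm_seq a 0%N).
  by apply: cvgB; [rewrite cvg_shiftS|exact: cvg_cst].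
by apply/funext => n; rewrite /series /= [in RHS]big_nat_recl// addrC addKr.
Qed.

Definition backshift a : ell2 R := Ell2 (backshift_subproof a).

Fact backshift_is_linear : linear backshift.
Proof. by move=> l a b; exact: ell2_ext. Qed.

HB.instance Definition _ :=
  GRing.isLinear.Build R[i] (ell2 R) (ell2 R) _ backshift backshift_is_linear.

Lemma ell2_rnorm_backshift a : ell2_rnorm (backshift a) <= ell2_rnorm a.
Proof.
rewrite ler_wsqrtr//; apply: limr_le; first exact: ell2_cvg.
apply: nearW => n.
have nd : nondecreasing_seq (series (sqnorm_seq a)).
  by apply: nondecreasing_series => k _ _; exact: sqnorm_seq_ge0.
apply: le_trans (nondecreasing_cvgn_le nd (@ell2_cvg _ a) n.+1).
by rewrite /series /= [leRHS]big_nat_recl//= lerDr sqnorm_seq_ge0.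
Qed.

Lemma backshift_continuous : continuous backshift.
Proof.
apply: bounded_linear_continuous; apply/linear_boundedP.
near=> r => a; apply: (@le_trans _ _ `|a|).
  by rewrite lecR ell2_rnorm_backshift.
by rewrite ler_peMl//; near: r; exact: nbhs_pinfty_ge.
Unshelve. all: by end_near. Qed.

Lemma scale_backshift_continuous (z : R[i]) : continuous (z \*: backshift).
Proof.
by move=> a; exact: (cvgZl_tmp (@backshift_continuous a)).
Qed.

End BackwardShift.

Section Hypercyclic.
Context (K : numDomainType) (X : tvsType K).

(* Hypercyclicity is only considered for continuous T; for the multiples of
   the backward shift this is scale_backshift_continuous. *)
Definition hypercyclic_vector (T : {linear X -> X}) (x : X) :=
  dense (range (fun n => iter n T x)).

Definition common_hypercyclic_vector (I : Type) (D : set I)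
    (T : I -> {linear X -> X}) (x : X) :=
  forall i, D i -> hypercyclic_vector (T i) x.

End Hypercyclic.

(* Main.v *)
Require Import Defs.
From HB Require Import structures.
From mathcomp Require Import all_boot all_order all_algebra.
From mathcomp Require Import all_classical all_reals all_analysis.
From mathcomp Require Import complex.
From mathcomp Require Import ring lra zify.

Set Implicit Arguments.
Unset Strict Implicit.
Unset Printing Implicit Defensive.

Import Order.TTheory GRing.Theory Num.Theory.
Import numFieldNormedType.Exports.

Local Open Scope classical_set_scope.
Local Open Scope ring_scope.

Import ComplexField.Normc.

(** The vector is a sum of blocks, each consisting of copies of a finitely
    supported target [g] scaled by weights [w k] and placed at the multiples
    [k N] of a large period [N]. The copy at time [n = k N] approximates [g]
    under [(zB)^n] when [z ^+ n * w k] is close to [1]; the later copies of the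
    block are then negligible, the moduli of the weights decaying geometrically.
    Times available in arithmetic progression cannot cover the two real
    parameters of [z] by cells of diameter about [1 / n], as the sum of the
    [n ^- 2] converges. The modulus and the phase of [z] are therefore treated
    separately: by Dirichlet's pigeonhole principle, a bounded number [L] of
    consecutive times, with [L] depending on the precision only, suffices for
    all phases at once, and the moduli are covered by runs of [L] times because
    the harmonic series diverges. All errors are estimated in the l1 norm,
    which dominates the l2 norm. *)

(** * Inequalities for the complex modulus *)

Section Modulus.
Context (R : realType).
Implicit Types x y z : R[i].

Lemma ler_normcD x y : normc (x + y) <= normc x + normc y.
Proof. exact: (@le_normcD R x y). Qed.

Lemma normcBC x y : normc (x - y) = normc (y - x).
Proof. by rewrite -opprB (@normcN R (y - x)). Qed.

Lemma ler_normc_triangle y x z : normc (x - z) <= normc (x - y) + normc (y - z).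
Proof. by rewrite (le_trans _ (ler_normcD _ _))// addrA subrK. Qed.

Lemma normcX z n : normc (z ^+ n) = normc z ^+ n.
Proof.
elim: n => [|n ih]; first by rewrite !expr0 [normc _]normc1.
by rewrite !exprS normcM ih.
Qed.

Lemma normc_real (r : R) : 0 <= r -> normc r%:C%C = r.
Proof. by move=> r0; rewrite /= expr0n/= addr0 sqrtr_sqr ger0_norm. Qed.

Lemma normc_sum n (F : nat -> R[i]) :
  normc (\sum_(i < n) F i) <= \sum_(i < n) normc (F i).
Proof.
elim: n => [|n ih]; first by rewrite !big_ord0 [normc _]normc0.
by rewrite !big_ord_recr/= (le_trans (ler_normcD _ _))// lerD2r.
Qed.

Lemma ler_normc_ReIm z : normc z <= `|complex.Re z| + `|complex.Im z|.
Proof.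
case: z => x y /=; rewrite -(@ler_pXn2r _ 2)// ?nnegrE ?addr_ge0 ?sqrtr_ge0//.
rewrite sqr_sqrtr ?addr_ge0 ?sqr_ge0//.
by rewrite -[x ^+ 2]real_normK ?num_real// -[y ^+ 2]real_normK ?num_real//;
  have := normr_ge0 x; have := normr_ge0 y; nra.
Qed.

Lemma normr_Re z : `|complex.Re z| <= normc z.
Proof.
case: z => x y /=; rewrite -sqrtr_sqr ler_wsqrtr// lerDl; exact: sqr_ge0.
Qed.

Lemma normr_Im z : `|complex.Im z| <= normc z.
Proof.
case: z => x y /=; rewrite -sqrtr_sqr ler_wsqrtr// lerDr; exact: sqr_ge0.
Qed.

Lemma polar_decomposition z : 0 < normc z ->
  exists2 b : R[i], normc b = 1 & z = (normc z)%:C%C * b.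
Proof.
move=> z0; have rz : (normc z)%:C%C != 0 :> R[i].
  by rewrite -(rmorph0 (real_complex R)) (inj_eq (@complexI R)) gt_eqF.
exists ((normc z)%:C%C^-1 * z); last by rewrite mulrA divff ?mul1r.
by rewrite normcM normcV normc_real ?ltW// mulVf// gt_eqF.
Qed.

End Modulus.

(** * Nets and the covering of all phases *)

Section PhaseCovering.
Context (R : realType).

Lemma interval_net (e : R) : 0 < e ->
  exists S (c : nat -> R), (forall j, (j < S)%N -> `|c j| <= 1) /\
    forall x, `|x| <= 1 -> exists2 j, (j < S)%N & `|x - c j| <= e.
Proof.
move=> e0; set m := (Num.truncn e^-1).+1.
have m0 : 0 < m%:R :> R by rewrite ltr0n.
have me : m%:R^-1 <= e.
  by rewrite invf_ple ?posrE// ltW// truncnS_gt.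
exists (m.*2.+1), (fun j => j%:R / m%:R - 1); split=> [j jm|x].
  have : j%:R / m%:R <= 2 :> R.
    by rewrite ler_pdivrMr// -natrM ler_nat mul2n.
  have : 0 <= j%:R / m%:R :> R by rewrite divr_ge0.
  by rewrite ler_norml; lra.
rewrite ler_norml => /andP[x1 x2].
have y0 : 0 <= (x + 1) * m%:R by rewrite mulr_ge0//; lra.
have /andP[h1 h2] := truncn_itv y0.
exists (Num.truncn ((x + 1) * m%:R)).
  rewrite ltnS truncn_le_nat.
  rewrite (le_lt_trans (y := m.*2%:R))//.
    by rewrite -mul2n natrM ler_wpM2r//; lra.
  by rewrite ltr_nat.
set t := Num.truncn _ in h1 h2 *.
have : t%:R / m%:R <= x + 1 by rewrite ler_pdivrMr.
have : x + 1 <= t%:R / m%:R + m%:R^-1.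
  rewrite -[X in _ <= _ + X]mul1r -mulrDl ler_pdivlMr// natr1; exact: ltW.
by rewrite ler_norml; lra.
Qed.

(** A product of two interval nets lies in a square rather than in the disk, whence the bound 2 on
    its points. *)
Lemma disk_net (e : R) : 0 < e ->
  exists S (c : nat -> R[i]), (forall j, (j < S)%N -> normc (c j) <= 2) /\
    forall x, normc x <= 1 -> exists2 j, (j < S)%N & normc (x - c j) <= e.
Proof.
move=> e0; have /interval_net[S [c [c1 cP]]] : 0 < e / 2 by rewrite divr_gt0.
exists (S * S)%N, (fun j => (c (j %/ S)%N +i* c (j %% S)%N)%C); split=> [j jS|x x1].
  have S0 : (0 < S)%N by case: (S) jS.
  have := ler_normc_ReIm (c (j %/ S)%N +i* c (j %% S)%N)%C => /= /le_trans->//.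
  by rewrite -[2]/(1 + 1) lerD// c1 ?ltn_mod// ltn_divLR.
have [j jS hj] := cP _ (le_trans (normr_Re x) x1).
have [k kS hk] := cP _ (le_trans (normr_Im x) x1).
exists (j * S + k)%N; first by nia.
have S0 : (0 < S)%N by case: (S) jS.
rewrite divnMDl// modnMDl divn_small// addn0 modn_small//.
apply: le_trans (ler_normc_ReIm _) _.
by case: x {x1} hj hk => a b /= hj hk; lra.
Qed.

(* Dirichlet's pigeonhole argument. *)
Lemma unimodular_return (e : R) : 0 < e -> exists D, forall b : R[i],
  normc b = 1 -> exists2 d, (d < D)%N & normc (b ^+ d.+1 - 1) <= e.
Proof.
move=> e0; have /disk_net[S [c [_ cP]]] : 0 < e / 2 by rewrite divr_gt0.
exists S => b b1.
have bX i : normc (b ^+ i) <= 1 by rewrite normcX b1 expr1n.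
have /choice[f fP] : forall i : 'I_S.+1, exists j : 'I_S,
    normc (b ^+ i - c j) <= e / 2.
  by move=> i; have [j jS hj] := cP _ (bX i); exists (Ordinal jS).
have /injectivePn[i [j ij fij]] : ~~ injectiveb f.
  by apply/injectiveP => /leq_card; rewrite !card_ord ltnn.
wlog {ij} ij : i j fij / (i < j)%N.
  move=> h; case: (ltngtP i j) => [|/h|/val_inj/eqP]; [exact: h|exact|].
  by rewrite (negPf ij).
exists (j - i).-1; first by case: i j {fij} ij => i hi [j hj]/=; lia.
have bi : b ^+ j - b ^+ i = b ^+ i * (b ^+ (j - i) - 1).
  by rewrite mulrBr mulr1 -exprD subnKC// ltnW.
rewrite prednK ?subn_gt0//.
rewrite -[leLHS]mul1r -[X in X * _ <= _](expr1n _ i) -b1 -normcX -normcM -bi.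
apply: le_trans (ler_normc_triangle (c (f i)) _ _) _.
rewrite (splitr e) lerD// ?[normc (c _ - _)]normcBC//.
by rewrite fij.
Qed.

(** Multiplication by [b] is isometric, so each further power adds at most [normc (b - 1)]. *)
Lemma normc_expr_sub1 (b : R[i]) n : normc b = 1 ->
  normc (b ^+ n - 1) <= n%:R * normc (b - 1).
Proof.
move=> b1; elim: n => [|n ih]; first by rewrite subrr [normc 0]normc0 mul0r.
have -> : b ^+ n.+1 - 1 = b * (b ^+ n - 1) + (b - 1) by rewrite exprS; ring.
apply: le_trans (ler_normcD _ _) _.
by rewrite normcM b1 mul1r -natr1 mulrDl mul1r lerD2r.
Qed.

(* Segment [d] uses the times [s + (d + 1) j]: if [b ^+ d.+1] is close to [1],
   the phase hardly moves along it, while [v] runs through a net. *)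
Lemma phase_covering (e : R) : 0 < e -> exists L (v : nat -> R[i]),
  (forall i, normc (v i) <= 2) /\
  forall a b, normc a = 1 -> normc b = 1 ->
    exists2 i, (i < L)%N & normc (a * b ^+ i * v i - 1) <= e.
Proof.
move=> e0; have /disk_net[S [c [c2 cP]]] : 0 < e / 2 by rewrite divr_gt0.
have S0 : 0 < 4 * S.+1%:R :> R by rewrite mulr_gt0.
(* Along a segment the phase drifts by fewer than [S] such steps, and net points have modulus at
   most 2: the drift costs at most [e / 2]. *)
have /unimodular_return[D DP] : 0 < e / (4 * S.+1%:R) by rewrite divr_gt0.
(* [W] leaves room for [S] steps of any length [d.+1 <= D]; an index [i] decodes into the segment
   [i %/ W] and the net index [j], with value 0 beyond the net. *)
pose W := (D * S)%N.
pose v i := let j := ((i %% W) %/ (i %/ W).+1)%N in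
  if (j < S)%N then c j else 0.
exists (D * W)%N, v; split=> [i|a b a1 b1].
  by rewrite /v; case: ifP => [/c2//|_]; rewrite [normc _]normc0.
have [d dD hd] := DP b b1.
pose s := a * b ^+ (d * W).
have s1 : normc s = 1 by rewrite normcM normcX a1 b1 expr1n mulr1.
have sV1 : normc s^-1 <= 1 by rewrite normcV s1 invr1.
have s0 : s != 0 by apply: contra_eq_neq s1 => ->; rewrite [normc _]normc0 eq_sym oner_eq0.
have [j jS hj] := cP _ sV1.
have jW : (d.+1 * j < W)%N by rewrite /W; nia.
exists (d * W + d.+1 * j)%N; first by nia.
have -> : v (d * W + d.+1 * j)%N = c j.
  have W0 : (0 < W)%N by case: (W) jW.
  by rewrite /v divnMDl// modnMDl (divn_small jW) addn0 (modn_small jW) mulKn// jS.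
rewrite exprD mulrA -/s exprM; clearbody s.
have -> : s * (b ^+ d.+1) ^+ j * c j - 1 =
    s * ((b ^+ d.+1) ^+ j - 1) * c j + s * (c j - s^-1).
  by field.
apply: le_trans (ler_normcD _ _) _.
rewrite !normcM s1 !mul1r [normc (c j - _)]normcBC (splitr e) lerD//.
have bd1 : normc (b ^+ d.+1) = 1 by rewrite normcX b1 expr1n.
apply: le_trans (ler_pM (normc_ge0 _) (normc_ge0 _) (normc_expr_sub1 j bd1) (c2 j jS)) _.
apply: (@le_trans _ _ (S.+1%:R * (e / (4 * S.+1%:R)) * 2)).
  rewrite ler_wpM2r// ler_pM//; first exact: normc_ge0.
  by rewrite ler_nat ltnW// ltnW.
have : S.+1%:R != 0 :> R by rewrite pnatr_eq0.
by move: S.+1%:R => n n0; rewrite le_eqVlt; apply/orP; left; apply/eqP; field.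
Qed.

End PhaseCovering.

(** * Elementary estimates for real sequences *)

Section RealEstimates.
Context (R : realType).
Implicit Types x q e : R.

Lemma geometric_sum_le2 x n : 0 <= x -> x <= 2^-1 -> \sum_(i < n) x ^+ i <= 2.
Proof.
move=> x0 x2; elim: n => [|n ih]; first by rewrite big_ord0.
rewrite big_ord_recl expr0; under eq_bigr do rewrite lift0 exprS.
by rewrite -mulr_sumr; have : 0 <= \sum_(i < n) x ^+ i;
  [apply: sumr_ge0 => i _; exact: exprn_ge0|nra].
Qed.

Lemma expr_eventually_le x e : 0 <= x -> x < 1 -> 0 < e ->
  exists N, forall n, (N <= n)%N -> x ^+ n <= e.
Proof.
move=> x0 x1 e0.
have /cvgrPdist_le/(_ e e0)[N _ NP] : (x ^+ n @[n --> \oo] --> 0).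
  by apply: cvg_expr; rewrite ger0_norm.
exists N => n Nn; have := NP n Nn.
by rewrite sub0r normrN ger0_norm ?exprn_ge0.
Qed.

(** Bernoulli's inequality yields the bound [1 / (1 - t)] with [t = n%:R * x], which is at most
    [1 + 2 * t] for [t <= 1 / 2]. *)
Lemma expr1D_le x e n : 0 <= x -> e <= 2^-1 -> n%:R * x <= e ->
  (1 + x) ^+ n <= 1 + 2 * e.
Proof.
move=> x0 e2 nx.
have bern : (1 + x) ^+ n * (1 - n%:R * x) <= 1.
  elim: n {nx} => [|n ih]; first by rewrite expr0 mul0r; lra.
  apply: le_trans ih; rewrite exprSr -mulrA ler_wpM2l ?exprn_ge0 ?addr_ge0//.
  rewrite -natr1; have := ler0n R n; nra.
have : 0 <= (1 + x) ^+ n by rewrite exprn_ge0// addr_ge0.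
have : 0 <= n%:R * x by rewrite mulr_ge0.
by move: ((1 + x) ^+ n) (n%:R * x) nx bern => y t te yt t0 y0; nra.
Qed.

Lemma harmonic_series_unbounded x : exists n, x <= series harmonic n.
Proof.
apply: contrapT => h; apply: (@dvg_harmonic R).
apply: nondecreasing_is_cvgn.
  by apply: nondecreasing_series => n _ _; exact: harmonic_ge0.
exists x => _ [n _ <-]; rewrite leNgt; apply/negP => xn.
by apply: h; exists n; exact: ltW.
Qed.

Lemma consecutive_bracket (rho : nat -> R) y J : rho 0%N <= y ->
  y <= rho J.+1 -> exists j, [/\ (j <= J)%N, rho j <= y & y <= rho j.+1].
Proof.
move=> y0; elim: J => [y1|J ih y1]; first by exists 0%N.
have [/ih[j [jJ h1 h2]]|/ltW yJ] := leP y (rho J.+1); last by exists J.+1.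
by exists j; split => //; exact: leqW.
Qed.

End RealEstimates.

(** * Weights adapted to an annulus *)

Section Weights.
Context (R : realType).

(* The real parameter [|z|] is covered by consecutive intervals
   [rho j, rho j.+1] of relative length about [1 / time]: the harmonic series
   diverges, so that finitely many of them reach [M]. The phase of [z] is
   handled inside each interval by [phase_covering]. *)
Lemma covering_weights (q M e : R) (N0 s0 : nat) : 1 < q -> 0 < e -> e <= 2^-1 ->
  exists N k0 k1 (w : nat -> R[i]),
  [/\ (N0 <= N)%N /\ (0 < N)%N, (s0 <= k0)%N,
      forall k, ~~ (k0 <= k < k1)%N -> w k = 0,
      forall n, \sum_(k < n) normc (w k) <= e &
      forall z, q <= normc z <= M -> exists k, (k0 <= k < k1)%N /\
        forall n, \sum_(i < n)
          normc (z ^+ (k * N) * w (k + i)%N - (i == 0%N :> nat)%:R) <= 5 * e].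
Proof.
move=> q1 e0 e2.
have q0 : 0 < q by exact: lt_trans q1.
have qV0 : 0 <= q^-1 by rewrite invr_ge0 ltW.
have qV1 : q^-1 < 1 by rewrite invf_lt1.
have e8 : 0 < e / 8 by rewrite divr_gt0.
have [N' N'P] := expr_eventually_le qV0 qV1 e8.
pose N := (maxn N' N0).+1.
pose x := q^-1 ^+ N.
have xe : x <= e / 8 by apply: N'P; rewrite leqW// leq_maxl.
have x0 : 0 <= x by exact: exprn_ge0.
have [L [v [v2 vP]]] := phase_covering e0.
have L0 : (0 < L)%N.
  by have [i iL _] := vP 1 1 (normc1 _) (normc1 _); case: (L) iL.
have h0 : 0 <= 2^-1 :> R by rewrite invr_ge0.
have h1 : 2^-1 < 1 :> R by rewrite invf_lt1// ltr1n.
have e4 : 0 < e / 4 by rewrite divr_gt0.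
have [k' k'P] := expr_eventually_le h0 h1 e4.
(* Starting late provides a factor [2^-1 ^+ k <= e / 4], which makes the moduli of the weights sum
   to at most [e]. *)
pose k0 := (maxn k' s0).
(* The relative length of interval [j] is at most [c / j.+1] and the times of its run are at most
   [N * (k0 + L) * j.+1]: their product stays below [e]. *)
pose c := e / (N * (k0 + L))%:R.
have c0 : 0 < c by rewrite divr_gt0// ltr0n muln_gt0 addn_gt0 L0 orbT.
pose H : nat -> R := series harmonic.
have H0 j : 0 <= H j by apply: sumr_ge0 => i _; exact: harmonic_ge0.
have HS j : H j.+1 = H j + j.+1%:R^-1 by rewrite /H /series /= big_nat_recr.
pose rho j := q * (1 + c * H j).
have rho_0 : rho 0%N = q by rewrite /rho /H /series/= big_geq// mulr0 addr0 mulr1.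
have rhoS j : rho j <= rho j.+1.
  by rewrite /rho ler_pM2l// lerD2l ler_pM2l// HS lerDl.
have rho_le : {homo rho : i j / (i <= j)%N >-> i <= j}.
  exact/nondecreasing_seqP.
have rhoq j : q <= rho j by rewrite /rho ler_pMr// lerDl mulr_ge0// ltW.
have rho0 j : 0 < rho j by exact: lt_le_trans (rhoq j).
have [J JP] := harmonic_series_unbounded (M / (q * c)).
have rhoJ : M <= rho J.+1.
  apply: le_trans (rhoS J).
  have {}JP : M <= H J * (q * c) by rewrite -ler_pdivrMr// mulr_gt0.
  by rewrite /rho mulrDr mulr1 mulrA [q * _ * _]mulrC ler_wpDl// ltW.
pose k1 := (k0 + J.+1 * L)%N.
(* Run [j] consists of [L] consecutive indices; the power of [rho j] offsets the modulus of
   [z ^+ (k * N)], and the entries of [v] are the candidates for its phase. *)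
pose w k : R[i] := if (k0 <= k < k1)%N then
  v ((k - k0) %% L)%N * ((rho ((k - k0) %/ L)%N)^-1 ^+ (k * N))%:C%C else 0.
have wn k : normc (w k) <= 2 * (rho ((k - k0) %/ L)%N)^-1 ^+ (k * N).
  rewrite /w; have ge0 : 0 <= (rho ((k - k0) %/ L)%N)^-1 ^+ (k * N).
    by rewrite exprn_ge0// invr_ge0 ltW.
  case: ifP => _; last by rewrite [normc _]normc0 mulr_ge0.
  by rewrite normcM normc_real// ler_wpM2r.
have rhoV j n : (rho j)^-1 ^+ n <= q^-1 ^+ n.
  by rewrite lerXn2r ?nnegrE ?invr_ge0 ?(ltW (rho0 _)) ?(ltW q0)// lef_pV2 ?posrE.
exists N, k0, k1, w; split.
- by split => //; rewrite leqW// leq_maxr.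
- exact: leq_maxr.
- by move=> k /negPf kn; rewrite /w kn.
- move=> n.
  have wk k : normc (w k) <= e / 2 * 2^-1 ^+ k.
    case: (boolP (k0 <= k < k1)%N) => [/andP[k0k _]|/negPf kn]; last first.
      by rewrite /w kn [normc _]normc0 mulr_ge0// ?exprn_ge0// divr_ge0// ltW.
    apply: le_trans (wn k) _.
    have hk : 2^-1 ^+ k <= e / 4 by apply/k'P/(leq_trans _ k0k)/leq_maxl.
    have : (rho ((k - k0) %/ L)%N)^-1 ^+ (k * N) <= 2^-1 ^+ k * 2^-1 ^+ k.
      apply: le_trans (rhoV _ _) _.
      rewrite mulnC exprM -/x -exprMn lerXn2r ?nnegrE ?mulr_ge0//; lra.
    have : 0 <= 2^-1 ^+ k :> R by exact: exprn_ge0.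
    move: hk; move: (2^-1 ^+ k) ((rho _)^-1 ^+ _) => y t ye ty y0.
    by apply: le_trans (_ : 2 * (y * y) <= _); [lra|nra].
  apply: le_trans (ler_sum _ (fun (k : 'I_n) _ => wk k)) _.
  rewrite -mulr_sumr; have := geometric_sum_le2 n h0 (lexx _).
  by move: (\sum_(i < n) _) => y; nra.
move=> z /andP[qz zM].
have [j [jJ jz zj]] : exists j, [/\ (j <= J)%N, rho j <= normc z &
    normc z <= rho j.+1].
  by apply: consecutive_bracket; rewrite ?rho_0// (le_trans zM).
have z0 : 0 < normc z by exact: lt_le_trans qz.
have [b b1 zb] := polar_decomposition z0.
have bX n : normc (b ^+ n) = 1 by rewrite normcX b1 expr1n.
(* The first argument is the phase at the start of run [j], the second the phase gained per
   index. *)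
have [i iL iP] := vP (b ^+ (N * (k0 + j * L))) (b ^+ N) (bX _) (bX _).
pose k := (k0 + j * L + i)%N.
have kk0 : (k - k0 = j * L + i)%N by rewrite /k -addnA addKn.
have kr : (k0 <= k < k1)%N.
  rewrite /k /k1 -addnA leq_addr ltn_add2l.
  by rewrite (@leq_trans (j.+1 * L))// ?leq_mul2r ?ltnS ?jJ ?orbT// mulSnr ltn_add2l.
(* [X] is the error made by replacing the modulus of [z] by the left end of its interval. *)
pose X := (normc z / rho j) ^+ (k * N).
have X1 : 1 <= X.
  by rewrite exprn_ege1// ler_pdivlMr ?mul1r.
have X2 : X <= 1 + 2 * e.
  have -> : X = (1 + (normc z / rho j - 1)) ^+ (k * N) by rewrite addrC subrK.
  apply: expr1D_le => //.
    by rewrite subr_ge0 ler_pdivlMr ?mul1r.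
  have zc : normc z / rho j - 1 <= c / j.+1%:R.
    rewrite lerBlDr ler_pdivrMr//; apply: le_trans zj _.
    have cj : 0 <= c / j.+1%:R by rewrite divr_ge0// ltW.
    have -> : rho j.+1 = rho j + c / j.+1%:R * q by rewrite /rho HS; ring.
    by rewrite mulrDl mul1r addrC lerD2r ler_wpM2l.
  apply: (@le_trans _ _ ((k * N)%:R * (c / j.+1%:R))); first by rewrite ler_wpM2l.
  rewrite /c -mulrA -invfM -natrM mulrCA ler_piMr ?(ltW e0)//.
  rewrite ler_pdivrMr ?mul1r ?ler_nat; last first.
    by rewrite ltr0n !muln_gt0/= addn_gt0 L0 orbT.
  have : (k <= (k0 + L) * j.+1)%N by rewrite /k; clear -iL; nia.
  by rewrite -mulnA [(N * _)%N]mulnC leq_pmul2r.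
have zk : z ^+ (k * N) = (X * rho j ^+ (k * N))%:C%C * b ^+ (k * N).
  by rewrite /X -exprMn divfK ?gt_eqF// rmorphXn -exprMn -zb.
(* As [X <= 1 + 2 * e <= 2], the phase costs at most [2 * e] and the modulus another [2 * e]. *)
have head_le : normc (z ^+ (k * N) * w k - 1) <= 4 * e.
  have -> : z ^+ (k * N) * w k - 1 =
      X%:C%C * (b ^+ (N * (k0 + j * L)) * (b ^+ N) ^+ i * v i - 1) + (X%:C%C - 1).
    rewrite {1}/w kr kk0 divnMDl// modnMDl (divn_small iL) addn0 (modn_small iL) zk.
    have -> : b ^+ (k * N) = b ^+ (N * (k0 + j * L)) * (b ^+ N) ^+ i.
      by rewrite -exprM -exprD -mulnDr mulnC.
    rewrite exprVn; set r := rho j ^+ _.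
    have r0 : r != 0 by rewrite expf_neq0// gt_eqF.
    have -> : (X * r)%:C%C = X%:C%C * r%:C%C by rewrite rmorphM.
    have rr : r%:C%C * (r^-1)%:C%C = 1 :> R[i] by rewrite -rmorphM divff.
    rewrite mulrBr mulr1 subrKA; congr (_ - 1).
    rewrite -[RHS]mulr1 -rr; move: (X%:C%C) (r%:C%C) (r^-1)%:C%C => X' r' r''.
    by ring.
  apply: le_trans (ler_normcD _ _) _.
  rewrite normcM normc_real ?(le_trans ler01 X1)//.
  have -> : X%:C%C - 1 = (X - 1)%:C%C :> R[i] by rewrite rmorphB.
  rewrite normc_real ?subr_ge0//.
  move: iP (normc_ge0 (b ^+ (N * (k0 + j * L)) * (b ^+ N) ^+ i * v i - 1)).
  by move: (normc _) => y ye y0; nra.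
(* Later radii are at least [rho j], so the powers with exponent [k * N] contribute at most
   [X <= 2]; another 2 bounds [v]. *)
have tail_le m : normc (z ^+ (k * N) * w (k + m)%N) <= 4 * x ^+ m.
  rewrite zk !normcM normcX b1 expr1n mulr1 normc_real; last first.
    by rewrite mulr_ge0 ?(le_trans ler01 X1)// exprn_ge0// ltW.
  set r := rho ((k + m - k0) %/ L)%N.
  have r0 : 0 < r by exact: rho0.
  have jr : rho j <= r.
    apply: rho_le; rewrite leq_divRL// -addnBAC; last by case/andP: kr.
    by rewrite kk0 -addnA leq_addr.
  have := wn (k + m)%N; rewrite -/r mulnDl exprD => wr.
  have a1 : rho j ^+ (k * N) * r^-1 ^+ (k * N) <= 1.
    rewrite -exprMn; apply: exprn_ile1.
      exact: divr_ge0 (ltW (rho0 j)) (ltW r0).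
    by rewrite ler_pdivrMr ?mul1r.
  have a2 : r^-1 ^+ (m * N) <= x ^+ m by rewrite -exprM [(N * m)%N]mulnC; exact: rhoV.
  have A0 : 0 <= rho j ^+ (k * N) by rewrite exprn_ge0// ltW.
  have B0 : 0 <= r^-1 ^+ (k * N) by rewrite exprn_ge0// invr_ge0 ltW.
  have C0 : 0 <= r^-1 ^+ (m * N) by rewrite exprn_ge0// invr_ge0 ltW.
  apply: le_trans (ler_wpM2l _ wr) _; first by rewrite mulr_ge0// (le_trans _ X1).
  set A := rho j ^+ _ in A0 a1 *; set B := r^-1 ^+ _ in B0 a1 *.
  set C := r^-1 ^+ _ in C0 a2 *.
  have -> : X * A * (2 * (B * C)) = (2 * X) * (A * B * C) by ring.
  apply: ler_pM; rewrite ?mulr_ge0// ?(le_trans _ X1)//; first by lra.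
  by rewrite -[x ^+ m]mul1r ler_pM// mulr_ge0.
exists k; split => // -[|n]; first by rewrite big_ord0 mulr_ge0// ltW.
rewrite big_ord_recl/= addn0.
(* The copy at [k] accounts for [4 * e]; the later ones sum to at most [8 * x <= e]. *)
have -> : 5 * e = 4 * e + e by ring.
rewrite lerD//.
under eq_bigr do rewrite subr0.
apply: le_trans (ler_sum _ (fun (m : 'I_n) _ => tail_le (lift ord0 m))) _.
under eq_bigr do rewrite lift0 exprS mulrA.
rewrite -mulr_sumr.
have xh : x <= 2^-1 by lra.
by have := geometric_sum_le2 n x0 xh; move: (\sum_(_ < n) _) => y; nra.
Qed.

End Weights.

(** * Bounds on absolute sums *)

Section AbsoluteSums.
Context (R : realType).
Implicit Types (a b : nat -> R[i]) (C : R).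

(** Partial sums express a bound on the l1 norm without any limit. *)
Definition l1_le a C := forall n, \sum_(i < n) normc (a i) <= C.

Lemma l1_le_weaken a C C' : l1_le a C -> C <= C' -> l1_le a C'.
Proof. by move=> aC CC n; apply: le_trans CC; exact: aC. Qed.

Lemma l1_leD a b C C' : l1_le a C -> l1_le b C' ->
  l1_le (fun n => a n + b n) (C + C').
Proof.
move=> aC bC n; apply: (@le_trans _ _ (\sum_(i < n) (normc (a i) + normc (b i)))).
  by apply: ler_sum => i _; exact: ler_normcD.
by rewrite big_split; exact: lerD (aC n) (bC n).
Qed.

Lemma l1_leZ (z : R[i]) a C : l1_le a C -> l1_le (fun n => z * a n) (normc z * C).
Proof.
move=> aC n; under eq_bigr do rewrite normcM.
by rewrite -mulr_sumr ler_wpM2l ?normc_ge0.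
Qed.

Lemma l1_le_shift m a C : l1_le a C -> l1_le (fun n => a (m + n)%N) C.
Proof.
move=> aC n; apply: le_trans (aC (m + n)%N).
by rewrite big_split_ord/= lerDr sumr_ge0// => i _; exact: normc_ge0.
Qed.

(** Exchanging the sums gives the bound. The cut at [i <= n] keeps an infinite superposition finite
    and loses nothing when [h i] vanishes before position [i]. *)
Lemma l1_le_sum (h : nat -> nat -> R[i]) (c : nat -> R) C :
  (forall i, l1_le (h i) (c i)) -> (forall n, \sum_(i < n) c i <= C) ->
  l1_le (fun n => \sum_(i < n.+1) h i n) C.
Proof.
move=> hc cC n; apply: le_trans (cC n).
apply: (@le_trans _ _ (\sum_(m < n) \sum_(i < n) normc (h i m))).
  apply: ler_sum => m _; apply: le_trans (normc_sum _ (fun i => h i m)) _.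
  rewrite (big_ord_widen n (fun i => normc (h i m)))//.
  by rewrite [leRHS](bigID (fun i : 'I_n => (i < m.+1)%N))/= lerDl sumr_ge0// =>
    i _; exact: normc_ge0.
by rewrite exchange_big/=; apply: ler_sum => i _; exact: hc.
Qed.

Lemma l1_le_finsupp a P : (forall n, (P <= n)%N -> a n = 0) ->
  l1_le a (\sum_(i < P) normc (a i)).
Proof.
move=> aP n; apply: (@le_trans _ _ (\sum_(i < P + n) normc (a i))).
  by rewrite addnC big_split_ord/= lerDl sumr_ge0// => i _; exact: normc_ge0.
rewrite big_split_ord/= [X in _ + X]big1 ?addr0// => i _.
by rewrite aP ?leq_addr// [normc _]normc0.
Qed.

Lemma l1_le_blocks N (e g : nat -> R[i]) E G : (0 < N)%N ->
  l1_le e E -> l1_le g G -> l1_le (fun l => e (l %/ N)%N * g (l %% N)%N) (E * G).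
Proof.
move=> N0 eE gG n.
have G0 : 0 <= G by have := gG 0%N; rewrite big_ord0.
have blocks m : \sum_(l < m * N) normc (e (l %/ N)%N * g (l %% N)%N) =
    (\sum_(i < m) normc (e i)) * \sum_(s < N) normc (g s).
  elim: m => [|m ih]; first by rewrite mul0n !big_ord0 mul0r.
  rewrite mulSnr big_split_ord/= ih big_ord_recr/= mulrDl; congr (_ + _).
  rewrite mulr_sumr; apply: eq_bigr => s _.
  by rewrite normcM divnMDl// modnMDl divn_small// addn0 modn_small.
apply: (@le_trans _ _ (\sum_(l < n * N) normc (e (l %/ N)%N * g (l %% N)%N))).
  rewrite -(subnKC (leq_pmulr n N0)) big_split_ord/= lerDl sumr_ge0// => i _.
  exact: normc_ge0.
rewrite blocks ler_pM ?sumr_ge0// => i _; exact: normc_ge0.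
Qed.

End AbsoluteSums.

(** * One block for one target *)

Section Stage.
Context (R : realType).

(** As [N >= P], the copies of [g] do not overlap, and the error at time [k * N] is again made of
    blocks, with the coefficient errors [u] in place of the weights. *)
Lemma covering_block (g : nat -> R[i]) (P p : nat) (q M d e : R) :
  (forall n, (P <= n)%N -> g n = 0) -> 1 < q -> 0 < d -> 0 < e ->
  exists (h : nat -> R[i]) p', [/\ (p < p')%N,
    forall n, ~~ (p <= n < p')%N -> h n = 0, l1_le h e &
    forall z, q <= normc z <= M -> exists2 n, (p <= n < p')%N &
      l1_le (fun l => z ^+ n * h (n + l)%N - g l) d].
Proof.
move=> gP q1 d0 e0.
pose G := \sum_(i < P) normc (g i).
have G0 : 0 <= G by apply: sumr_ge0 => i _; exact: normc_ge0.
have gG : l1_le g G := l1_le_finsupp gP.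
have G1 : 0 < 5 * (G + 1) by rewrite mulr_gt0// ltr_wpDl.
(* The factor 5 comes from the error [5 * t] of the weights; [G + 1] avoids a division by 0. *)
pose t := Num.min 2^-1 (Num.min (d / (5 * (G + 1))) (e / (5 * (G + 1)))).
have t0 : 0 < t by rewrite /t !lt_min !divr_gt0// invr_gt0 ltr0n.
have t2 : t <= 2^-1 by rewrite /t ge_min lexx.
have td : t * (5 * (G + 1)) <= d by rewrite -ler_pdivlMr// /t !ge_min lexx !orbT.
have te : t * (5 * (G + 1)) <= e by rewrite -ler_pdivlMr// /t !ge_min lexx !orbT.
have [N [k0 [k1 [w [[PN N0] pk w0 wt wP]]]]] := covering_weights M P p.+1 q1 t0 t2.
have gN l : (N <= l)%N -> g l = 0 by move=> Nl; exact/gP/(leq_trans PN).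
exists (fun n => w (n %/ N)%N * g (n %% N)%N), (maxn p.+1 (k1 * N)); split.
- exact: leq_maxl.
- move=> n np; rewrite w0 ?mul0r//; apply: contra np => /andP[h1 h2].
  apply/andP; split; last by rewrite leq_max -ltn_divLR// h2 orbT.
  rewrite leq_divRL// in h1; apply: leq_trans h1.
  by rewrite (leq_trans (ltnW pk))// leq_pmulr.
- refine (l1_le_weaken (l1_le_blocks N0 (wt : l1_le w t) gG) _); nra.
move=> z zq; have [k [/andP[kk0 kk1] kP]] := wP z zq.
exists (k * N)%N.
  rewrite leq_max ltn_pmul2r// kk1 orbT andbT.
  by rewrite (leq_trans (ltnW pk))// (leq_trans kk0)// leq_pmulr.
pose u i := z ^+ (k * N) * w (k + i)%N - (i == 0%N :> nat)%:R.
have -> : (fun l => z ^+ (k * N) * (w ((k * N + l) %/ N)%N * g ((k * N + l) %% N)%N)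
      - g l) =
    (fun l => u (l %/ N)%N * g (l %% N)%N).
  apply/funext => l; rewrite /u divnMDl// modnMDl mulrBl mulrA; congr (_ - _).
  have [lN|Nl] := ltnP l N; first by rewrite divn_small// modn_small// mul1r.
  by rewrite gN// gtn_eqF ?divn_gt0// mul0r.
refine (l1_le_weaken (l1_le_blocks N0 (kP : l1_le u (5 * t)) gG) _); nra.
Qed.

End Stage.

(** * Superposition of the blocks *)

Section Assembly.
Context (R : realType).

(** If [c 1] is negative, all later terms are nonpositive; otherwise induction applies to the
    shifted sequence. *)
Lemma sum_halving (c : nat -> R) n : (forall i, c i.+1 <= c i / 2) ->
  0 <= c 0%N -> \sum_(i < n) c i <= 2 * c 0%N.
Proof.
move=> cS; elim: n c cS => [|n ih] c cS c0; first by rewrite big_ord0 mulr_ge0.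
have [c1|c1] := leP 0 (c 1%N).
  rewrite big_ord_recl; under eq_bigr do rewrite lift0.
  have := ih (fun i => c i.+1) (fun i => cS i.+1) c1; have := cS 0%N.
  by move=> /=; move: (\sum_(_ < n) _) => s; lra.
have cneg i : c i.+1 <= 0.
  elim: i => [|i ci]; first exact: ltW.
  by apply: le_trans (cS _) _; lra.
rewrite big_ord_recl; under eq_bigr do rewrite lift0.
have : \sum_(i < n) c i.+1 <= 0 by apply: sumr_le0.
by move: (\sum_(_ < n) _) => s; lra.
Qed.

(* The block of stage [i] is so small that, multiplied by [M j ^+ n] for an
   earlier stage [j] and any time [n] used by it, it still is negligible. *)
Lemma simultaneous_approximation (g : nat -> nat -> R[i]) (P : nat -> nat)
    (q M d : nat -> R) :
  (forall i n, (P i <= n)%N -> g i n = 0) -> (forall i, 1 < q i) ->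
  (forall i, 1 <= M i) -> (forall i, 0 < d i) ->
  exists2 f : nat -> R[i], exists C, l1_le f C &
  forall i z, q i <= normc z <= M i ->
    exists n, l1_le (fun l => z ^+ n * f (n + l)%N - g i l) (2 * d i).
Proof.
move=> gP q1 M1 d0.
(* [S] sends a stage index, a starting position and a budget to a block and its end; a dummy serves
   nonpositive budgets. *)
have /choice[S SP] : forall x : nat * nat * R, exists y : (nat -> R[i]) * nat,
    0 < x.2 -> [/\ (x.1.2 < y.2)%N,
      forall n, ~~ (x.1.2 <= n < y.2)%N -> y.1 n = 0, l1_le y.1 x.2 &
      forall z, q x.1.1 <= normc z <= M x.1.1 ->
        exists2 n, (x.1.2 <= n < y.2)%N &
        l1_le (fun l => z ^+ n * y.1 (n + l)%N - g x.1.1 l) (d x.1.1)].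
  move=> [[i p] e] /=; have [e0|_] := ltP 0 e; last by exists (fun=> 0, 0%N).
  have [h [p' [h1 h2 h3 h4]]] := covering_block p (M i) (gP i) (q1 i) (d0 i) e0.
  by exists (h, p').
(* The end [p'] bounds the times of stage [i]; the budget is halved for summability and made small
   against [M i ^+ p']. *)
pose next i (s : nat * R) := let p' := (S (i, s.1, s.2)).2 in
  (p', Num.min (s.2 / 2) (d i / (2 * M i ^+ p'))).
pose st := fix st i := if i is j.+1 then next j (st j) else (0%N, 1 : R).
pose p i := (st i).1; pose e i := (st i).2.
pose h i := (S (i, p i, e i)).1.
have MX i n : 0 < M i ^+ n by rewrite exprn_gt0// (lt_le_trans _ (M1 i)).
have e0 i : 0 < e i.
  elim: i => [|i ih]; first exact: ltr01.
  rewrite /e /= /next /= lt_min -/(e i) divr_gt0//=.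
  by rewrite divr_gt0// mulr_gt0.
have pS i : p i.+1 = (S (i, p i, e i)).2 by [].
have e2 i : e i.+1 <= e i / 2 by rewrite /e /= /next /= ge_min lexx.
have eM i : 2 * e i.+1 * M i ^+ p i.+1 <= d i.
  have : e i.+1 <= d i / (2 * M i ^+ p i.+1).
    by rewrite pS /e /= /next /= ge_min lexx orbT.
  by rewrite ler_pdivlMr ?mulr_gt0// mulrCA mulrA.
have stP i := SP (i, p i, e i) (e0 i).
have p_lt i : (p i < p i.+1)%N by have [] := stP i.
have p_le : {homo p : i j / (i <= j)%N >-> (i <= j)%N}.
  by apply: homo_leq => // [j i k|i]; [exact: leq_trans|exact: ltnW].
have p_ge i : (i <= p i)%N by elim: i => // i ih; exact: leq_ltn_trans (p_lt i).
have h0 i n : ~~ (p i <= n < p i.+1)%N -> h i n = 0 by have [_ + _ _] := stP i; exact.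
have hle i : l1_le (h i) (e i) by have [] := stP i.
(* [F s] superposes the stages from [s] on; the cut is harmless, as stage [s + i] starts no earlier
   than [i]. *)
pose F s n : R[i] := \sum_(i < n.+1) h (s + i)%N n.
have Fle s : l1_le (F s) (2 * e s).
  apply: (@l1_le_sum _ (fun i => h (s + i)%N) (fun i => e (s + i)%N)) => [i|n].
    exact: hle.
  rewrite -[X in e X]addn0; apply: (@sum_halving (fun i => e (s + i)%N)).
    by move=> i; rewrite addnS.
  exact: ltW.
exists (F 0%N); first by exists (2 * e 0%N); exact: Fle.
move=> i z /[dup] zq /andP[_ zM].
have [_ _ _ /(_ z zq)[n /andP[pn np] nP]] := stP i.
exists n.
have F0 m : (p i <= m)%N -> F 0%N m = h i m + F i.+1 m.
  move=> pm; have im : (i <= m)%N := leq_trans (p_ge i) pm.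
  have -> : F 0%N m = \sum_(j < i.+1 + m.+1) h j m.
    rewrite addnC big_split_ord/= [X in _ + X]big1 ?addr0// => j _.
    rewrite h0// negb_and -ltnNge; apply/orP; left.
    by apply: leq_trans (p_ge _); rewrite leq_addr.
  rewrite big_split_ord/= big_ord_recr/= [X in X + h i m]big1 ?add0r// => j _.
  rewrite h0// negb_and -leqNgt; apply/orP; right.
  by apply: leq_trans pm; exact: p_le.
have -> : (fun l => z ^+ n * F 0%N (n + l)%N - g i l) =
    (fun l => (z ^+ n * h i (n + l)%N - g i l) + z ^+ n * F i.+1 (n + l)%N).
  by apply/funext => l; rewrite F0 ?(leq_trans pn)// ?leq_addr// mulrDr addrAC.
have tail := l1_leZ (z ^+ n) (l1_le_shift n (Fle i.+1)).
refine (l1_le_weaken (l1_leD nP tail) _).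
have -> : 2 * d i = d i + d i by ring.
rewrite /= lerD2l normcX.
apply: le_trans (eM i); rewrite mulrC ler_pM2l ?mulr_gt0//.
apply: (@le_trans _ _ (M i ^+ n)).
  by rewrite lerXn2r ?nnegrE ?normc_ge0// (le_trans ler01).
by rewrite ler_weXn2l// ltnW.
Qed.

End Assembly.

(** * Passage to [ell2] and a countable dense set *)

Section SquareSums.
Context (R : realType).
Implicit Types a : nat -> R[i].

Lemma square_summable_bounded a B :
  (forall n, \sum_(i < n) normc (a i) ^+ 2 <= B) -> a \in @square_summable R.
Proof.
move=> aB; apply/asboolP/nondecreasing_is_cvgn.
  by apply: nondecreasing_series => n _ _; exact: sqnorm_seq_ge0.
by exists B => _ [n _ <-]; rewrite /series /= big_mkord; exact: aB.
Qed.

Lemma ell2_rnorm_le (x : ell2 R) C : 0 <= C ->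
  (forall n, \sum_(i < n) normc (x i) ^+ 2 <= C ^+ 2) -> ell2_rnorm x <= C.
Proof.
move=> C0 xC; rewrite -(@ler_pXn2r _ 2)// ?nnegrE ?ell2_rnorm_ge0//.
rewrite ell2_rnorm_sqr; apply: limr_le; first exact: ell2_cvg.
by apply: nearW => n; rewrite /series /= big_mkord; exact: xC.
Qed.

Lemma l1_le_sqr a C : l1_le a C -> forall n, \sum_(i < n) normc (a i) ^+ 2 <= C ^+ 2.
Proof.
move=> aC n.
have C0 : 0 <= C by have := aC 0%N; rewrite big_ord0.
have a_le i : normc (a i) <= C.
  apply: le_trans (aC i.+1); rewrite big_ord_recr/= lerDr sumr_ge0// => j _.
  exact: normc_ge0.
apply: (@le_trans _ _ (\sum_(i < n) C * normc (a i))).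
  by apply: ler_sum => i _; rewrite expr2 ler_wpM2r// normc_ge0.
by rewrite -mulr_sumr expr2 ler_wpM2l.
Qed.

Lemma iter_scale_backshift (z : R[i]) (f : ell2 R) n l :
  iter n (z \*: @backshift R) f l = z ^+ n * f (n + l)%N.
Proof.
elim: n l => [|n ih] l; first by rewrite expr0 mul1r.
transitivity (z * iter n (z \*: @backshift R) f l.+1); first by [].
by rewrite ih exprS mulrA addnS.
Qed.

Definition ratC (c : rat * rat) : R[i] := (ratr c.1 +i* ratr c.2)%C.

(** Lists of rational pairs form a countable type, so that [pickle] enumerates the targets. *)
Definition rat_seq (s : seq (rat * rat)) (n : nat) : R[i] := ratC (nth (0, 0) s n).

Lemma rat_seq_finsupp s n : (size s <= n)%N -> rat_seq s n = 0.
Proof. by move=> sn; rewrite /rat_seq nth_default// /ratC/= rmorph0. Qed.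

Lemma rat_seq_square_summable s : rat_seq s \in @square_summable R.
Proof.
apply: square_summable_bounded; apply: l1_le_sqr; apply: (@l1_le_finsupp _ _ (size s)).
exact: rat_seq_finsupp.
Qed.

Lemma ratC_dense (x : R[i]) (e : R) : 0 < e -> exists c, normc (x - ratC c) <= e.
Proof.
move=> e0.
have rat_near (r : R) : exists q : rat, `|r - ratr q| <= e / 2.
  have [|q] := @rat_in_itvoo R (r - e / 2) (r + e / 2); first lra.
  by rewrite in_itv/= => /andP[h1 h2]; exists q; rewrite ler_norml; lra.
have [p pP] := rat_near (complex.Re x); have [q qP] := rat_near (complex.Im x).
exists (p, q); apply: le_trans (ler_normc_ReIm _) _.
by rewrite (splitr e); case: x pP qP => a b /= h1 h2; exact: lerD.
Qed.

(** Truncation at a suitable [P] costs at most [e ^+ 2 / 2] in the squared norm; rounding [P]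
    coordinates within [t] costs at most the square of [e / 2]. *)
Lemma ell2_rat_seq_dense (x : ell2 R) (e : R) : 0 < e ->
  exists s, ell2_rnorm (x - Ell2 (rat_seq_square_summable s)) <= e.
Proof.
move=> e0; pose S := series (sqnorm_seq x).
have SE n : S n = \sum_(i < n) normc (x i) ^+ 2 by rewrite /S /series /= big_mkord.
have Snd : nondecreasing_seq S.
  by apply: nondecreasing_series => n _ _; exact: sqnorm_seq_ge0.
have e22 : 0 < e ^+ 2 / 2 by rewrite divr_gt0// exprn_gt0.
have [P _ /(_ P (leqnn P))] := cvgr_dist_le _ _ (ell2_cvg (a := x)) _ e22.
rewrite ger0_norm ?subr_ge0; last exact: nondecreasing_cvgn_le (@ell2_cvg _ x) P.
rewrite -/S => SP.
pose t := e / (2 * P.+1%:R).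
have t0 : 0 < t by rewrite divr_gt0// mulr_gt0.
have /choice[c cP] : forall i, exists c, normc (x i - ratC c) <= t.
  by move=> i; exact: ratC_dense.
exists (mkseq c P); apply: ell2_rnorm_le; first exact: ltW.
move=> n; set y := x - _.
have yE i : y i = x i - rat_seq (mkseq c P) i by [].
clearbody y.
apply: (@le_trans _ _ (\sum_(i < P + n) normc (y i) ^+ 2)).
  by rewrite addnC big_split_ord/= lerDl sumr_ge0// => i _; exact: sqr_ge0.
rewrite big_split_ord/= (splitr (e ^+ 2)) lerD//.
  apply: (@le_trans _ _ (\sum_(i < P) t ^+ 2)).
    apply: ler_sum => i _; rewrite lerXn2r ?nnegrE ?normc_ge0 ?(ltW t0)//.
    by rewrite yE /rat_seq nth_mkseq.
  rewrite sumr_const card_ord -mulr_natl.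
  have P1 : 1 <= P.+1%:R :> R by rewrite ler1n.
  have tP : t * P.+1%:R = e / 2.
    by rewrite /t; field; rewrite gt_eqF// (lt_le_trans _ P1).
  clearbody t; have PP : P%:R <= P.+1%:R :> R by rewrite ler_nat.
  have P0 := ler0n R P.
  have : P%:R * t ^+ 2 <= (P.+1%:R * t) ^+ 2.
    by rewrite exprMn ler_wpM2r ?sqr_ge0//; nra.
  by rewrite [_.+1%:R * t]mulrC tP; nra.
apply: le_trans SP; rewrite lerBrDl.
apply: le_trans (nondecreasing_cvgn_le Snd (@ell2_cvg _ x) (P + n)).
rewrite !SE big_split_ord/= lerD2l; apply: ler_sum => i _.
by rewrite yE rat_seq_finsupp ?subr0// size_mkseq leq_addr.
Qed.

End SquareSums.

(** * Enumeration of targets and annuli *)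

Theorem mainTheorem1 (R : realType) :
  exists f : ell2 R,
    common_hypercyclic_vector [set z : R[i] | 1 < `|z|]
      (fun z : R[i] => z \*: @backshift R) f.
Proof.
pose target i : seq (rat * rat) * nat := odflt ([::], 0%N) (unpickle i).
pose g i := @rat_seq R (target i).1.
(* [u i] is both the precision and the distance of the annulus from the unit circle; with its
   inverse as outer radius, the annuli exhaust [|z| > 1]. *)
pose u i : R := (target i).2.+1%:R^-1.
have u0 i : 0 < u i by rewrite invr_gt0.
have [f [C fC] fP] := @simultaneous_approximation R g
  (fun i => size (target i).1) (fun i => 1 + u i)
  (fun i => (target i).2.+1%:R) u
  (fun i => @rat_seq_finsupp R (target i).1)
  (fun i => ltac:(by rewrite ltrDl)) (fun i => ltac:(by rewrite ler1n)) u0.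
exists (Ell2 (square_summable_bounded (l1_le_sqr fC))) => z.
rewrite /= -[1]/(1%:C%C) -[`|z|]/((normc z)%:C%C) ltcR => z1 O [x Ox] oO.
have /nbhs_normP[[e e'] /=] : nbhs x O by exact: open_nbhs_nbhs.
(* The radius is an element of [R[i]]; its positivity forces the imaginary part [e'] to be 0. *)
rewrite ltcE/= => /andP[/eqP e'0 e0] xO.
have [s sx] := ell2_rat_seq_dense x (divr_gt0 e0 (ltr0n R 2)).
(* Exceeding these three bounds puts [z] in the annulus of index [i] and makes [2 * u i] smaller
   than [e / 2]. *)
pose m := Num.truncn (Num.max (normc z) (Num.max (normc z - 1)^-1 (8 / e))).
have [zm z1m em] : [/\ normc z < m.+1%:R, (normc z - 1)^-1 < m.+1%:R &
  8 / e < m.+1%:R].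
  have := truncnS_gt (Num.max (normc z) (Num.max (normc z - 1)^-1 (8 / e))).
  by rewrite -/m !gt_max => /and3P.
pose i := pickle (s, m).
have iE : target i = (s, m) by rewrite /target pickleK.
have m0 : 0 < m.+1%:R :> R by rewrite ltr0n.
have ui : u i = m.+1%:R^-1 by rewrite /u iE.
have [|n nP] := fP i z.
  rewrite iE/= (ltW zm) ui andbT -lerBrDl -[leRHS]invrK lef_pV2 ?posrE//.
    exact: ltW.
  by rewrite invr_gt0 subr_gt0.
set F := Ell2 _; exists (iter n (z \*: @backshift R) F); split; last by exists n.
pose y := Ell2 (@rat_seq_square_summable R s).
have yo : ell2_rnorm (y - iter n (z \*: @backshift R) F) <= 2 * u i.
  apply: ell2_rnorm_le; first by rewrite mulr_ge0// ltW.
  move=> k; apply: le_trans (l1_le_sqr nP k); apply: ler_sum => l _.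
  have := iter_scale_backshift z F n l; rewrite {2}/F/= => <-.
  by rewrite normcBC /g iE.
have uie : 2 * u i < e / 2.
  have : u i < e / 8.
    by rewrite ui -[ltRHS]invrK invf_div ltf_pV2 ?posrE// divr_gt0.
  by lra.
apply: xO; rewrite /ball_/= ltcE/= e'0 eqxx/=.
have -> : x - iter n (z \*: @backshift R) F =
  (x - y) + (y - iter n (z \*: @backshift R) F) by rewrite addrA subrK.
apply: le_lt_trans (ell2_rnormD _ _) _.
by rewrite [ltRHS]splitr ler_ltD// (le_lt_trans yo).
Qed.
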